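(* Consider a control-function decision rule $d:\mathcal Z\to\mathcal A$, where $d((x^*,y^* ))$ is obtained as the coefficient on $x^*$ in a linear regression of $y^*$ on $x^*$, controlling for $$x^*-\bigl(c(\|x_z^*\|,\|x_r^*\|)\,(x_z^* )',\ \mathbf 0'\bigr)',$$ where $c(\|x_z^*\|,\|x_r^*\|)$ is scalar (and measurable). Then $d$ is an invariant decision rule with respect to the actions of $G=\mathbb R\times O(\ell)\times O(s)$ given in the context; that is, for all $(g,(x^*,y^* ))\in G\times\mathcal Z$, $$d\bigl(m_{\mathcal Z}(g,(x^*,y^* ))\bigr)=m_{\mathcal A}\bigl(g,d((x^*,y^* ))\bigr).$$
   Context: Let $\ell,s\ge 1$ be integers. The sample space is $\mathcal Z=(\mathbb R^{\ell+s})^2$, with elements $(x^*,y^* )$; the action space is $\mathcal A=\mathbb R$; the parameter space is $\Theta=\mathbb R\times\mathbb R^\ell\times\mathbb R^3_{\ge 0}$, with elements $\theta=(\beta,\mu,\rho,\sigma,\tau)$, where $\beta$ is the parameter to be estimated. For $x^*\in\mathbb R^{\ell+s}$, $x_z^*\in\mathbb R^\ell$ denotes its first $\ell$ coordinates and $x_r^*\in\mathbb R^s$ its last $s$ coordinates; $\|\cdot\|$ is the Euclidean norm, $'$ denotes transpose, and $\mathbf 0$ is the zero vector in $\mathbb R^s$. $O(m)$ is the group of orthonormal matrices in $\mathbb R^{m\times m}$ under matrix multiplication, and $G=\mathbb R\times O(\ell)\times O(s)$ is the product group, with $\mathbb R$ under addition. For $g=(g_\beta,g_z,g_r)\in G$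 the actions of $G$ on $\mathcal Z$, $\Theta$ and $\mathcal A$ are $$m_{\mathcal Z}(g,(x^*,y^* ))=\left(\begin{pmatrix}g_z&0\\0&g_r\end{pmatrix}x^*,\ \begin{pmatrix}g_z&0\\0&g_r\end{pmatrix}(y^*+g_\beta x^* )\right),$$ $$m_\Theta(g,\theta)=(\beta+g_\beta,\,g_z\mu,\,\rho,\sigma,\tau),\qquad m_{\mathcal A}(g,a)=a+g_\beta .$$ A decision rule $d:\mathcal Z\to\mathcal A$ is called invariant if $d(m_{\mathcal Z}(g,(x^*,y^* )))=m_{\mathcal A}(g,d((x^*,y^* )))$ for all $(g,(x^*,y^* ))\in G\times\mathcal Z$. The linear regression is least squares without intercept: with $b=x^*-(c(\|x_z^*\|,\|x_r^*\|)(x_z^* )',\mathbf 0')'$ the control vector and $A=\mathbb I-b(b'b)^{-1}b'$ (with $\mathbb I$ the identity matrix of size $\ell+s$), the coefficient on $x^*$ is $d((x^*,y^* ))=\dfrac{(x^* )'A\,y^*}{(x^* )'A\,x^*}$.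
   Formalization: The identity is stated for the samples with (x* )'A x* ≠ 0, where the coefficient is defined (A = I if the control is zero), and this set is shown to be G-invariant; on all of Z it fails, since (0,0) is fixed by G while the action on A adds g_β. *)

(* Defs.v *)
From HB Require Import structures.
From mathcomp Require Import all_boot all_order all_algebra.
From mathcomp Require Import all_classical all_reals all_analysis.
Set Implicit Arguments. Unset Strict Implicit. Unset Printing Implicit Defensive.
Import Order.TTheory GRing.Theory Num.Theory.
Local Open Scope classical_set_scope.
Local Open Scope ring_scope.

(* The Euclidean norm: the norm `|x| that MathComp-Analysis puts on matrices is
   the sup norm. *)
Definition enorm (R : realType) (n : nat) (x : 'cV[R]_n) : R :=
  Num.sqrt (\sum_(i < n) x i 0 ^+ 2).

Definition orthogonal_group (R : realType) (m : nat) : Type :=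
  {M : 'M[R]_m | M^T *m M == 1%:M}.

Section ControlFunction.
Context {R : realType} {l s : nat}.

Definition sample : Type := ('cV[R]_(l + s) * 'cV[R]_(l + s))%type.
Definition action : Type := R.

Record transformation : Type := Transformation {
  g_beta : R;
  g_z : orthogonal_group R l;
  g_r : orthogonal_group R s
}.

Definition rotation (g : transformation) : 'M[R]_(l + s) :=
  block_mx (val (g_z g)) 0 0 (val (g_r g)).

Definition m_Z (g : transformation) (z : sample) : sample :=
  (rotation g *m z.1, rotation g *m (z.2 + g_beta g *: z.1)).

Definition m_A (g : transformation) (a : action) : action := a + g_beta g.

(* Invariance of a rule that is only meaningful on the set D of samples: D is
   preserved by the group and d is equivariant on D. For D = setT this is
   invariance of an everywhere defined rule; no rule satisfies that, because
   (0, 0) is fixed by the group whereas m_A translates R. *)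
Definition invariant_on (D : set sample) (d : sample -> action) : Prop :=
  forall (g : transformation) (z : sample),
    D z -> D (m_Z g z) /\ d (m_Z g z) = m_A g (d z).

Definition control (c : R -> R -> R) (x : 'cV[R]_(l + s)) : 'cV[R]_(l + s) :=
  x - col_mx (c (enorm (usubmx x)) (enorm (dsubmx x)) *: usubmx x) 0.

(* If b = 0 then invmx (b^T *m b) = 0, hence annihilator b = 1%:M: a zero
   control is no control. *)
Definition annihilator (b : 'cV[R]_(l + s)) : 'M[R]_(l + s) :=
  1%:M - b *m invmx (b^T *m b) *m b^T.

(* x' A w, where A annihilates the control built from x. *)
Definition partial_form (c : R -> R -> R) (x w : 'cV[R]_(l + s)) : R :=
  (x^T *m annihilator (control c x) *m w) 0 0.

Definition control_function_rule (c : R -> R -> R) (z : sample) : action :=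
  partial_form c z.1 z.2 / partial_form c z.1 z.1.

(* The samples at which the coefficient on x is determined, that is, at which
   the quotient above is not a division by zero. *)
Definition coefficient_defined (c : R -> R -> R) : set sample :=
  [set z | partial_form c z.1 z.1 != 0].

End ControlFunction.

Arguments sample : clear implicits.
Arguments transformation : clear implicits.

(* Main.v *)
Require Import Defs.
From HB Require Import structures.
From mathcomp Require Import all_boot all_order all_algebra.
From mathcomp Require Import all_classical all_reals all_analysis.
Set Implicit Arguments. Unset Strict Implicit. Unset Printing Implicit Defensive.
Import Order.TTheory GRing.Theory Num.Theory.
Local Open Scope classical_set_scope.
Local Open Scope ring_scope.

(** Write [Q] for the block rotation of a transformation [g]. Since [Q] is
orthogonal and acts separately on the two blocks of [x], it preserves both
block norms, so the scalar [c] takes the same value at [Q x] as at [x]; this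
makes the control equivariant, [b(Q x) = Q b(x)] ([control_rotation]). The
annihilator of the rotated control is then the conjugate of the original one by
[Q], and the bilinear form [x' A w] takes the same value at [(Q x, Q w)] as at
[(x, w)] ([partial_form_rotation]). So the rotation leaves the numerator and
the denominator of the coefficient unchanged; in particular the denominator
stays nonzero. The translation of [y] by [g_beta x] adds [g_beta] times the
denominator to the numerator, because the form is linear in [w]; dividing, the
coefficient moves by exactly [g_beta]. *)

Lemma enormE (R : realType) (n : nat) (x : 'cV[R]_n) :
  enorm x = Num.sqrt ((x^T *m x) 0 0).
Proof.
by rewrite /enorm mxE; congr Num.sqrt; apply: eq_bigr => i _; rewrite mxE expr2.
Qed.

Lemma enorm_orthogonal (R : realType) (n : nat) (M : orthogonal_group R n)
    (x : 'cV[R]_n) :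
  enorm (val M *m x) = enorm x.
Proof.
by rewrite !enormE trmx_mul mulmxA -(mulmxA x^T) (eqP (valP M)) mulmx1.
Qed.

Lemma rotation_orthogonal (R : realType) (l s : nat)
    (g : transformation R l s) :
  (rotation g)^T *m rotation g = 1%:M.
Proof.
rewrite /rotation tr_block_mx mulmx_block !trmx0 !mulmx0 !mul0mx !addr0 !add0r.
by rewrite (eqP (valP (g_z g))) (eqP (valP (g_r g))) -scalar_mx_block.
Qed.

Lemma usubmx_rotation (R : realType) (l s : nat) (g : transformation R l s)
    (x : 'cV[R]_(l + s)) :
  usubmx (rotation g *m x) = val (g_z g) *m usubmx x.
Proof. by rewrite -{1}(vsubmxK x) mul_block_col col_mxKu mul0mx addr0. Qed.

Lemma dsubmx_rotation (R : realType) (l s : nat) (g : transformation R l s)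
    (x : 'cV[R]_(l + s)) :
  dsubmx (rotation g *m x) = val (g_r g) *m dsubmx x.
Proof. by rewrite -{1}(vsubmxK x) mul_block_col col_mxKd mul0mx add0r. Qed.

(** The coefficient [c] depends on the two block norms only, and these are
preserved, while the vector that [c] multiplies is rotated within its block. *)
Lemma control_rotation (R : realType) (l s : nat) (c : R -> R -> R)
    (g : transformation R l s) (x : 'cV[R]_(l + s)) :
  control c (rotation g *m x) = rotation g *m control c x.
Proof.
rewrite /control usubmx_rotation dsubmx_rotation !enorm_orthogonal mulmxBr.
by rewrite mul_block_col !mulmx0 mul0mx !addr0 scalemxAr.
Qed.

(** [Q] leaves [b' b] unchanged, hence also its [invmx], whether or not [b]
vanishes; the factors [Q^T] and [Q] then cancel against the two outer [b]. *)
Lemma annihilator_isometry (R : realType) (l s : nat)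
    (Q : 'M[R]_(l + s)) (b : 'cV[R]_(l + s)) :
  Q^T *m Q = 1%:M ->
  Q^T *m annihilator (Q *m b) *m Q = annihilator b.
Proof.
move=> QQ; rewrite /annihilator.
have -> : (Q *m b)^T *m (Q *m b) = b^T *m b.
  by rewrite trmx_mul mulmxA -(mulmxA b^T) QQ mulmx1.
rewrite mulmxBr mulmxBl mulmx1 QQ trmx_mul; congr (_ - _).
by rewrite !mulmxA QQ mul1mx -[LHS]mulmxA QQ mulmx1.
Qed.

Lemma partial_form_rotation (R : realType) (l s : nat) (c : R -> R -> R)
    (g : transformation R l s) (x w : 'cV[R]_(l + s)) :
  partial_form c (rotation g *m x) (rotation g *m w) = partial_form c x w.
Proof.
rewrite /partial_form control_rotation.
rewrite -(annihilator_isometry (control c x) (rotation_orthogonal g)).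
by rewrite trmx_mul !mulmxA.
Qed.

Lemma partial_formDZ (R : realType) (l s : nat) (c : R -> R -> R)
    (x v w : 'cV[R]_(l + s)) (a : R) :
  partial_form c x (v + a *: w) = partial_form c x v + a * partial_form c x w.
Proof. by rewrite /partial_form mulmxDr -scalemxAr !mxE. Qed.

Theorem proposition2 (R : realType) (l s : nat) (c : R -> R -> R)
    (l_ge1 : (1 <= l)%N) (s_ge1 : (1 <= s)%N)
    (c_meas : measurable_fun [set p : R * R | 0 <= p.1 /\ 0 <= p.2]
                             (fun p : R * R => c p.1 p.2)) :
  @invariant_on R l s (coefficient_defined c) (control_function_rule c).
Proof.
move=> g [x y]; rewrite /coefficient_defined /control_function_rule /m_A /=.
move=> xAx_neq0; rewrite !partial_form_rotation; split=> //.
by rewrite partial_formDZ mulrDl mulfK.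
Qed.
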